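(* There are exactly seven signed graphs with underlying graph the complete graph $K_5$ up to switching isomorphism.
   Context: All graphs are finite, simple and undirected. A signed graph is a pair $\Sigma=(\Gamma,\sigma)$ where $\Gamma=(V_\Gamma,E_\Gamma)$ is a graph (the underlying graph) and $\sigma:E_\Gamma\to\{+1,-1\}$ is a sign function. For a switching function $\theta:V_\Gamma\to\{+1,-1\}$, define $\Sigma^\theta=(\Gamma,\sigma^\theta)$ by $\sigma^\theta(uv)=\theta(u)\sigma(uv)\theta(v)$ for every $uv\in E_\Gamma$. Two signed graphs $\Sigma_1,\Sigma_2$ with the same underlying graph $\Gamma$ are switching equivalent if $\Sigma_2=\Sigma_1^\theta$ for some switching function $\theta$. Two signed graphs $(\Gamma_1,\sigma_1)$ and $(\Gamma_2,\sigma_2)$ are isomorphic if there is a graph isomorphism $\Gamma_1\to\Gamma_2$ preserving the signs of edges. Two signed graphs $\Sigma_1,\Sigma_2$ are switching isomorphic if $\Sigma_1$ is isomorphic to a signed graph which is switching equivalent to $\Sigma_2$. *)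

(* Defs.v *)
From HB Require Import structures.
From mathcomp Require Import all_boot all_order all_algebra.

Set Implicit Arguments.
Unset Strict Implicit.
Unset Printing Implicit Defensive.

Import GRing.Theory.

Record graph := Graph {
  vertex :> finType;
  edges : {set {set vertex}};
  card_edge : forall e, e \in edges -> #|e| = 2
}.

Definition edge (G : graph) := {e : {set G} | e \in edges G}.

Lemma card_complete_edge n (e : {set 'I_n}) :
  e \in [set e : {set 'I_n} | #|e| == 2] -> #|e| = 2.
Proof. by rewrite inE => /eqP. Qed.

Definition complete_graph (n : nat) : graph :=
  Graph (@card_complete_edge n).

(* A sign is a boolean b standing for (-1) ^+ b: false is +1, true is -1, and
   the product of signs is addb (see signr_addb). *)
Definition sign := bool.

Definition signed_graph (G : graph) := {ffun edge G -> sign}.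

(* The big xor over the two endpoints of e is the product of the values of
   theta at these endpoints; see switchE. *)
Definition switch (G : graph) (S : signed_graph G) (theta : G -> sign) :
    signed_graph G :=
  [ffun e => S e (+) \big[addb/false]_(v in val e) theta v].

Lemma switchE (G : graph) (S : signed_graph G) (theta : G -> sign)
    (e : edge G) (u v : G) :
  val e = [set u; v] ->
  ((-1) ^+ switch S theta e = (-1) ^+ theta u * (-1) ^+ S e * (-1) ^+ theta v
    :> int)%R.
Proof.
move=> euv; have := card_edge (valP e); rewrite euv cards2 => -[].
case: eqVneq => // uv _; rewrite ffunE euv big_setU1 ?inE //= big_set1.
by rewrite !signr_addb mulrCA mulrA.
Qed.

Definition switching_equivalent (G : graph) (S1 S2 : signed_graph G) : Prop :=
  exists theta : G -> sign, S2 = switch S1 theta.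

Definition graph_isomorphism (G1 G2 : graph) (f : G1 -> G2) : Prop :=
  bijective f /\
  forall u v : G1, ([set f u; f v] \in edges G2) = ([set u; v] \in edges G1).

Definition signed_isomorphic (G1 G2 : graph)
    (S1 : signed_graph G1) (S2 : signed_graph G2) : Prop :=
  exists f : G1 -> G2, graph_isomorphism f /\
    forall (e1 : edge G1) (e2 : edge G2),
      val e2 = f @: val e1 -> S2 e2 = S1 e1.

Definition switching_isomorphic (G1 G2 : graph)
    (S1 : signed_graph G1) (S2 : signed_graph G2) : Prop :=
  exists S : signed_graph G2,
    signed_isomorphic S1 S /\ switching_equivalent S S2.

(* Main.v *)
Require Import Defs.
From mathcomp Require Import all_boot all_order all_algebra.

(** Since 5 is odd, switching at the vertices of odd negative degree turns any
    signed K_5 into one whose negative edges form an even graph (handshake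
    lemma), and this even graph depends only on the switching class. The number
    of negative edges of this even graph takes the seven values
    0, 3, 4, 5, 6, 7, 10 and determines it up to isomorphism: the empty graph,
    C_3, C_4, C_5, the bowtie, the complement of C_3, and K_5. *)

Set Implicit Arguments.
Unset Strict Implicit.
Unset Printing Implicit Defensive.

(** * Signed complete graphs as relations on vertices *)

Section CompleteGraph.

Variable n : nat.
Implicit Types (S T : signed_graph (complete_graph n)) (u v : 'I_n).

(** Working with a relation on vertices avoids carrying edge proofs; the default [false] is the
    value on the diagonal, where [[set u; u]] is not an edge. *)
Definition neg S u v : bool :=
  oapp S false (insub [set u; v] : option (edge (complete_graph n))).

Definition signed_of_rel (a : rel 'I_n) : signed_graph (complete_graph n) :=
  [ffun e : edge (complete_graph n) =>
    [exists u in val e, exists v in val e, a u v]].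

Lemma edge_complete u v :
  ([set u; v] \in edges (complete_graph n)) = (u != v).
Proof. by rewrite inE cards2; case: (u != v). Qed.

Definition mk_edge u v (uv : u != v) : edge (complete_graph n) :=
  exist _ [set u; v] (etrans (edge_complete u v) uv).

Lemma complete_edgeP (e : edge (complete_graph n)) :
  exists u v, u != v /\ val e = [set u; v].
Proof.
have /eqP/cards2P[u [v [uv ->]]] := card_edge (valP e).
by exists u, v.
Qed.

Lemma negE S (e : edge (complete_graph n)) u v :
  val e = [set u; v] -> neg S u v = S e.
Proof. by rewrite /neg => <-; rewrite valK. Qed.

Lemma negxx S u : neg S u u = false.
Proof. by rewrite /neg insubF // edge_complete eqxx. Qed.

Lemma neg_sym S : symmetric (neg S).
Proof. by move=> u v; rewrite /neg setUC. Qed.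

Lemma neg_inj S T : neg S =2 neg T -> S = T.
Proof.
move=> eq_neg; apply/ffunP => e; have [u [v [_ euv]]] := complete_edgeP e.
by rewrite -!(negE _ euv).
Qed.

Lemma neg_signed_of_rel (a : rel 'I_n) :
  symmetric a -> irreflexive a -> neg (signed_of_rel a) =2 a.
Proof.
move=> a_sym a_irr u v.
have [<-|uv] := eqVneq u v; first by rewrite negxx a_irr.
rewrite (@negE _ (mk_edge uv)) // ffunE /=.
apply/existsP/idP => [[x /andP[xuv /existsP[y /andP[yuv]]]]|auv].
  move: xuv yuv; rewrite !inE.
  by do 2![case/orP=> /eqP->]; rewrite ?a_irr // a_sym.
by exists u; rewrite set21; apply/existsP; exists v; rewrite set22.
Qed.

Lemma neg_switch S theta u v :
  neg (switch S theta) u v = theta u (+) neg S u v (+) theta v.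
Proof.
have [<-|uv] := eqVneq u v; first by rewrite !negxx addbF addbb.
rewrite !(@negE _ (mk_edge uv)) // ffunE /=.
by rewrite big_setU1 ?inE //= big_set1 addbCA addbA.
Qed.

(** Any injection of the finite vertex set into itself is an automorphism of the complete graph, so
    only signs have to be compared. *)
Lemma switching_isomorphic_completeP S T :
  switching_isomorphic S T <->
  exists (f : 'I_n -> 'I_n) (theta : 'I_n -> bool), injective f /\
    forall u v, neg T (f u) (f v) = theta u (+) neg S u v (+) theta v.
Proof.
split=> [[S' [[f [[f_bij f_edge] fS]] [theta ->]]]|[f [theta [f_inj fST]]]].
  exists f, (theta \o f); split=> [|u v]; first exact: bij_inj f_bij.
  rewrite neg_switch /=; congr (_ (+) _ (+) _).
  have [<-|uv] := eqVneq u v; first by rewrite !negxx.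
  have fuv : f u != f v by rewrite (inj_eq (bij_inj f_bij)).
  rewrite (@negE S (mk_edge uv)) // (@negE S' (mk_edge fuv)) //.
  by apply: fS; rewrite /= imsetU1 imset_set1.
have [g fK gK] := injF_bij f_inj.
(* Switching is an involution, so the intermediate graph is [T] switched back, with [theta]
   transported along [f]. *)
exists (switch T (theta \o g)); split; last first.
  exists (theta \o g); apply: neg_inj => u v; rewrite !neg_switch /=.
  by rewrite !addbA addbb addFb -addbA addbb addbF.
exists f; split.
  split; first by exists g.
  by move=> u v; rewrite !edge_complete (inj_eq f_inj).
move=> e1 e2; have [u [v [uv e1uv]]] := complete_edgeP e1.
rewrite e1uv imsetU1 imset_set1 => e2uv.
rewrite -(negE _ e1uv) -(negE _ e2uv) neg_switch /= !fK fST.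
by rewrite !addbA addbb addFb -addbA addbb addbF.
Qed.

(** * The even part as a switching invariant *)

Implicit Types a b : rel 'I_n.

Definition odd_degree a u := \big[addb/false]_v a u v.

Definition even_part a : rel 'I_n :=
  fun u v => odd_degree a u (+) a u v (+) odd_degree a v.

Lemma even_part_sym a : symmetric a -> symmetric (even_part a).
Proof.
by move=> a_sym u v; rewrite /even_part a_sym addbC addbCA addbC.
Qed.

Lemma even_part_irr a : irreflexive a -> irreflexive (even_part a).
Proof. by move=> a_irr u; rewrite /even_part a_irr addbF addbb. Qed.

Lemma big_addb_const (m : nat) c : \big[addb/false]_(i < m) c = odd m && c.
Proof.
elim: m => [|m IHm]; first by rewrite big_ord0.
by rewrite big_ord_recl IHm /=; case: (odd m); rewrite ?addbb ?addbF.
Qed.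

Lemma handshake a : symmetric a -> irreflexive a ->
  \big[addb/false]_u odd_degree a u = false.
Proof.
move=> a_sym a_irr; rewrite /odd_degree.
(* Ordered pairs split into [u < v], [v < u] and the diagonal. The diagonal contributes nothing, and
   swapping coordinates shows that the other two sums are equal, so they cancel. *)
rewrite pair_big /= (bigID (fun p : 'I_n * 'I_n => (p.1 < p.2)%N)) /=.
rewrite [X in _ (+) X](bigID (fun p : 'I_n * 'I_n => (p.2 < p.1)%N)) /=.
rewrite [X in _ (+) (_ (+) X)]big1 ?addbF => [|[u v] /=]; last first.
  rewrite -!leqNgt => /andP[vu uv].
  by rewrite (@ord_inj _ u v) //; apply/eqP; rewrite eqn_leq uv vu.
rewrite [X in _ (+) X](reindex_inj (h := fun p => (p.2, p.1))) /=; last first.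
  by move=> [u v] [u' v'] [-> ->].
rewrite [X in _ (+) X](eq_bigl
  (fun p : 'I_n * 'I_n => (p.1 < p.2)%N)); last first.
  by move=> [u v] /=; case: ltngtP.
rewrite [X in X (+) _](eq_bigr (fun p => a p.2 p.1)) ?addbb //.
Qed.

Hypothesis odd_n : odd n.

(** Summing over [v], the term [odd_degree a u] occurs [n] times and so survives once; it cancels
    against the sum of [a u v], and the remaining sum vanishes by the handshake lemma. *)
Lemma even_partP a u : symmetric a -> irreflexive a ->
  odd_degree (even_part a) u = false.
Proof.
move=> a_sym a_irr; rewrite [LHS]big_split /= handshake // addbF.
by rewrite big_split /= big_addb_const odd_n addbb.
Qed.

(** For odd [n], switching changes the degree parity at [u] by [theta u] plus a constant. In
    [even_part] the constant occurs twice and each [theta] value cancels. *)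
Lemma even_part_switch a b (f : 'I_n -> 'I_n) theta : injective f ->
  (forall u v, b (f u) (f v) = theta u (+) a u v (+) theta v) ->
  forall u v, even_part b (f u) (f v) = even_part a u v.
Proof.
move=> f_inj fab.
have degE u : odd_degree b (f u) =
    theta u (+) odd_degree a u (+) \big[addb/false]_v theta v.
  rewrite /odd_degree (reindex_inj f_inj) /=.
  by under eq_bigr do rewrite fab; rewrite !big_split /= big_addb_const odd_n.
move=> u v; rewrite /even_part !degE fab.
move: (odd_degree a u) (odd_degree a v) (theta u) (theta v) (a u v).
by move: (\big[_/_]_ _ _) => [] [] [] [] [] [].
Qed.

(* Counts ordered pairs, hence each edge twice. *)
Definition even_size a := \sum_u \sum_v even_part a u v.

Lemma even_size_switch S T :
  switching_isomorphic S T -> even_size (neg S) = even_size (neg T).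
Proof.
move=> /switching_isomorphic_completeP[f [theta [f_inj fST]]].
rewrite /even_size [RHS](reindex_inj f_inj) /=; apply: eq_bigr => u _.
rewrite [RHS](reindex_inj f_inj) /=; apply: eq_bigr => v _.
by rewrite (even_part_switch f_inj fST).
Qed.

End CompleteGraph.

(** * The seven even graphs on five vertices *)

Definition even_graphs : seq (seq (nat * nat)) :=
  [:: [::];
      [:: (0, 1); (1, 2); (0, 2)];
      [:: (0, 1); (1, 2); (2, 3); (0, 3)];
      [:: (0, 1); (1, 2); (2, 3); (3, 4); (0, 4)];
      [:: (0, 1); (0, 2); (1, 2); (0, 3); (0, 4); (3, 4)];
      [:: (0, 3); (0, 4); (1, 3); (1, 4); (2, 3); (2, 4); (3, 4)];
      [:: (0, 1); (0, 2); (0, 3); (0, 4); (1, 2);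
          (1, 3); (1, 4); (2, 3); (2, 4); (3, 4)]].

Definition even_rel (k u v : nat) : bool :=
  let E := nth [::] even_graphs k in ((u, v) \in E) || ((v, u) \in E).

Definition even_rel5 (k : nat) : rel 'I_5 := fun u v => even_rel k u v.

Lemma even_rel5_sym k : symmetric (even_rel5 k).
Proof. by move=> u v; rewrite /even_rel5 /even_rel orbC. Qed.

Lemma even_rel5_irr k : irreflexive (even_rel5 k).
Proof.
move=> u; rewrite /even_rel5 /even_rel orbb.
(* Indices past the end of the list give the empty graph. *)
by case: u => -[|[|[|[|[|u]]]]] //= _; do 8?[case: k => [|k] //].
Qed.

(** Each listed graph is its own even part, so these are twice the numbers of edges; being distinct,
    they separate the seven classes. *)
Lemma even_size_even_rel5 (i : 'I_7) :
  even_size (even_rel5 i) = nth 0 [:: 0; 6; 8; 10; 12; 14; 20] i.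
Proof.
rewrite /even_size /even_part /odd_degree /even_rel5.
rewrite !big_ord_recl !big_ord0 /=.
by case: i => -[|[|[|[|[|[|[|i]]]]]]].
Qed.

Definition pairs5 : seq (nat * nat) :=
  [:: (0, 1); (0, 2); (0, 3); (0, 4); (1, 2);
      (1, 3); (1, 4); (2, 3); (2, 4); (3, 4)].

(** A graph is coded by its values [w] along [pairs5] and a vertex permutation by its list of values
    [p], so that isomorphism can be tested by computation. *)
Definition embeds (w : seq bool) (k : nat) (p : seq nat) : bool :=
  w == [seq even_rel k (nth 0 p q.1) (nth 0 p q.2) | q <- pairs5].

(* The edges inside {1, 2, 3, 4} determine an even graph on {0, 1, 2, 3, 4}. *)
Lemma embeds_even x12 x13 x14 x23 x24 x34 :
  has (fun k => has (embeds [:: x12 (+) x13 (+) x14; x12 (+) x23 (+) x24;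
      x13 (+) x23 (+) x34; x14 (+) x24 (+) x34;
      x12; x13; x14; x23; x24; x34] k) (permutations (iota 0 5))) (iota 0 7).
Proof. by case: x12 x13 x14 x23 x24 x34 => [] [] [] [] [] []; vm_compute. Qed.

Lemma even_rel5_classification (e : rel 'I_5) : symmetric e -> irreflexive e ->
  (forall u, odd_degree e u = false) ->
  exists (k : 'I_7) (f : 'I_5 -> 'I_5), injective f /\
    forall u v, even_rel5 k (f u) (f v) = e u v.
Proof.
move=> e_sym e_irr e_even.
pose x i j := e (inord i) (inord j).
have x_sym i j : x i j = x j i by exact: e_sym.
(* Even degree at [i] expresses the entry at 0 through the others, which gives the first four
   entries in [embeds_even]. *)
have row i : x i 0 = x i 1 (+) x i 2 (+) x i 3 (+) x i 4.
  have := e_even (inord i); rewrite /odd_degree.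
  rewrite (eq_bigr (fun j : 'I_5 => x i j)) => [|j _]; last first.
    by rewrite /x inord_val.
  rewrite !big_ord_recl big_ord0 /= !/bump /=.
  by move: (x i 0) (x i 1) (x i 2) (x i 3) (x i 4) => [] [] [] [] [].
have xx i : x i i = false by exact: e_irr.
have /hasP[k] := embeds_even (x 1 2) (x 1 3) (x 1 4) (x 2 3) (x 2 4) (x 3 4).
rewrite mem_iota => /andP[_ ltk] /hasP[p].
rewrite mem_permutations => p_perm p_emb.
have p_size : size p = 5 by rewrite (perm_size p_perm) size_iota.
have p_lt i : (i < 5)%N -> (nth 0 p i < 5)%N.
  move=> lti; have : nth 0 p i \in p by rewrite mem_nth ?p_size.
  by rewrite (perm_mem p_perm) mem_iota.
have embE : embeds [seq x q.1 q.2 | q <- pairs5] k p.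
  rewrite /= (x_sym 0 1) (x_sym 0 2) (x_sym 0 3) (x_sym 0 4) !row !xx.
  by rewrite (x_sym 2 1) (x_sym 3 1) (x_sym 4 1) (x_sym 3 2) (x_sym 4 2)
    (x_sym 4 3) !addbF !addFb.
exists (Ordinal ltk), (fun u => inord (nth 0 p u)); split=> [u v|].
  move=> /(congr1 (@nat_of_ord 5)); rewrite !inordK ?p_lt // => /eqP.
  rewrite nth_uniq ?p_size // ?(perm_uniq p_perm) ?iota_uniq //.
  by move=> /eqP/ord_inj.
(* [pairs5] lists only increasing pairs; symmetry and irreflexivity give the rest. *)
have lt_emb (u v : 'I_5) : (u < v)%N ->
    even_rel5 k (inord (nth 0 p u)) (inord (nth 0 p v)) = e u v.
  move=> uv; rewrite /even_rel5 !inordK ?p_lt //.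
  rewrite -[u in RHS]inord_val -[v in RHS]inord_val -/(x u v).
  have uv_in : (val u, val v) \in pairs5.
    by case: u v uv => [[|[|[|[|[|u]]]]] ltu] [[|[|[|[|[|v]]]]] ltv].
  by move: embE => /eqP/eq_in_map/(_ _ uv_in) /= ->.
move=> u v; case: (ltngtP u v) => [|vu|/ord_inj ->]; first exact: lt_emb.
  by rewrite even_rel5_sym e_sym lt_emb.
by rewrite e_irr even_rel5_irr.
Qed.

Theorem theorem4p1 :
  exists S : 'I_7 -> signed_graph (complete_graph 5),
    (forall i j : 'I_7, switching_isomorphic (S i) (S j) -> i = j) /\
    (forall T : signed_graph (complete_graph 5),
       exists i : 'I_7, switching_isomorphic T (S i)).
Proof.
pose S (i : 'I_7) := signed_of_rel (even_rel5 i).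
have negS i : neg (S i) =2 even_rel5 i.
  by apply: neg_signed_of_rel; [apply: even_rel5_sym | apply: even_rel5_irr].
have sizeS i : even_size (neg (S i)) = even_size (even_rel5 i).
  have degS u : odd_degree (neg (S i)) u = odd_degree (even_rel5 i) u.
    by apply: eq_bigr => v _; rewrite negS.
  by do 2![apply: eq_bigr => ? _]; rewrite /even_part !degS negS.
exists S; split=> [i j|T].
  move=> /(even_size_switch (n := 5) isT).
  rewrite !sizeS !even_size_even_rel5 => /eqP.
  by rewrite nth_uniq // => /eqP/ord_inj.
have neg_irr : irreflexive (neg T) by exact: negxx.
have [i [f [f_inj fE]]] := even_rel5_classification
  (even_part_sym (@neg_sym _ T)) (even_part_irr neg_irr)
  (fun u => even_partP (n := 5) isT u (@neg_sym _ T) neg_irr).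
exists i; apply/switching_isomorphic_completeP.
(* By definition, [even_part] is the switching by degree parities, which are therefore the switching
   function needed. *)
by exists f, (odd_degree (neg T)); split=> // u v; rewrite negS fE.
Qed.
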